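(* Let $(H,1)$ be a unital $\ell$-subgroup of $(\mathbb R,1)$, let $G$ be an $\ell$-group, and let $M=\Gamma(H\overrightarrow{\times}G,(1,0))$ be the corresponding strongly $(H,1)$-perfect pseudo MV-algebra, with $2<|M|$. Suppose that $M$ has a square root. If $G$ enjoys unique extraction of roots, then $H$ and $G$ are two-divisible. In general, if $G$ does not enjoy unique extraction of roots, then for each $g\in G$ the set $\{x\in G\mid 2x=g\}$ has a top element in $G$.
   Context: $\ell$-groups (lattice-ordered groups) are written additively and need not be Abelian. A unital $\ell$-group $(K,v)$ is an $\ell$-group $K$ with a fixed strong unit $v\ge 0$ (for each $g\in K$ there is an integer $n\ge1$ with $g\le nv$). $\Gamma(K,v)=([0,v];\oplus,^-,^\sim,0,v)$ with $x\oplus y=(x+y)\wedge v$, $x^-=v-x$, $x^\sim=-x+v$; in it $x\odot y:=(y^-\oplus x^-)^\sim=(x-v+y)\vee 0$, and the order is that of $K$. Pseudo MV-algebras are, up to isomorphism, exactly the algebras $\Gamma(K,v)$. Put $x\to y:=x^-\oplus y$, $x\rightsquigarrow y:=y\oplus x^\sim$. $H$ is a subgroup of $\mathbb R$ containing $1$; $H\overrightarrow{\times}G$ is the lexicographic product (the group $H\times G$ ordered lexicographically, first coordinate first), with strong unit $(1,0)$. The strongly $(H,1)$-perfect pseudo MV-algebras are exactly, up to isomorphism, the algebras $\Gamma(H\overrightarrow{\times}G,(1,0))$ with $G$ an $\ell$-group. A square root on a pseudo MV-algebra $M$ is a map $r:M\to M$ such that (Sq1) $r(x)\odot r(x)=x$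 for all $x$; (Sq2) $y\odot y\le x$ implies $y\le r(x)$; (Sq3) $r(x^-)=r(x)\to r(0)$ and $r(x^\sim)=r(x)\rightsquigarrow r(0)$ for all $x$. An $\ell$-group $G$ enjoys unique extraction of roots if for every integer $n\ge1$ and $g,h\in G$, $ng=nh$ implies $g=h$. It is two-divisible if for each $g\in G$ there is $h\in G$ with $2h=g$. A top element of a subset is its greatest element (belonging to the subset). *)

(* Defs.v *)
From HB Require Import structures.
From mathcomp Require Import all_boot all_order all_algebra.
From mathcomp Require Import classical_sets cardinality reals.

Set Implicit Arguments.
Unset Strict Implicit.
Unset Printing Implicit Defensive.

Import Order.TTheory.

Local Open Scope order_scope.
Local Open Scope group_scope.

Fact lgroup_display : Order.disp_t. Proof. exact: Order.Disp tt tt. Qed.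

(* The possibly non-Abelian groups of the library (groupType) are written
   multiplicatively: the additive 0, x + y, - x, x - y, - x + y, n x of an
   l-group are here 1, x * y, x^-1, x / y, x^-1 * y, x ^+ n. *)
HB.mixin Record isLGroup G
    of Group G & Order.Lattice lgroup_display G := {
  lg_leM2 : forall a b x y : G, x <= y -> a * x * b <= a * y * b
}.

#[short(type="lGroupType")]
HB.structure Definition LGroup :=
  { G of isLGroup G & Group G & Order.Lattice lgroup_display G }.

#[short(type="totalLGroupType")]
HB.structure Definition TotalLGroup :=
  { G of LGroup G & Order.Total lgroup_display G }.

Definition strong_unit (K : lGroupType) (v : K) : Prop :=
  1 <= v /\ forall g : K, exists2 n : nat, (1 <= n)%N & g <= v ^+ n.

Definition unique_root_extraction (G : lGroupType) : Prop :=
  forall (n : nat) (g h : G), (1 <= n)%N -> g ^+ n = h ^+ n -> g = h.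

Definition two_divisible (G : lGroupType) : Prop :=
  forall g : G, exists h : G, h ^+ 2 = g.

Definition top_element (G : lGroupType) (A : set G) (t : G) : Prop :=
  A t /\ ubound A t.

Section LGroupTheory.
Variable G : lGroupType.
Implicit Types a x y : G.

Lemma lg_leM2l a x y : (a * x <= a * y) = (x <= y).
Proof.
have H (b u v : G) : u <= v -> b * u <= b * v.
  by move=> /(lg_leM2 b 1); rewrite !mulg1.
by apply/idP/idP => [/(H a^-1)|/H//]; rewrite !mulKg.
Qed.

Lemma lg_leM2r a x y : (x * a <= y * a) = (x <= y).
Proof.
have H (b u v : G) : u <= v -> u * b <= v * b.
  by move=> /(lg_leM2 1 b); rewrite !mul1g.
by apply/idP/idP => [/(H a^-1)|/H//]; rewrite !mulgK.
Qed.

Lemma lg_leV2 x y : (x^-1 <= y^-1) = (y <= x).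
Proof.
by rewrite -(lg_leM2l x x^-1) mulgV -(lg_leM2r y 1) mul1g mulgVK.
Qed.

Lemma lg_invg_meet x y : (x `&` y)^-1 = x^-1 `|` y^-1.
Proof.
apply/le_anti/andP; split.
  rewrite -lg_leV2 invgK lexI -lg_leV2 invgK leUl /=.
  by rewrite -lg_leV2 invgK leUr.
by rewrite leUx !lg_leV2 leIl leIr.
Qed.

Lemma lg_joinM a x y : (x `|` y) * a = (x * a) `|` (y * a).
Proof.
apply/le_anti/andP; split; last by rewrite leUx !lg_leM2r leUl leUr.
rewrite -(lg_leM2r a^-1) mulgK leUx.
by rewrite -(lg_leM2r a x) -(lg_leM2r a y) !mulgVK leUl leUr.
Qed.

End LGroupTheory.

Record unitalLGroup := UnitalLGroup {
  ul_group :> lGroupType;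
  ul_unit : ul_group;
  ul_unitP : strong_unit ul_unit
}.

Record Gamma (K : unitalLGroup) := GammaElt {
  gval :> K;
  gvalP : 1 <= gval <= ul_unit K
}.

HB.instance Definition _ (K : unitalLGroup) := [isSub for @gval K].
HB.instance Definition _ (K : unitalLGroup) := [Choice of Gamma K by <:].
HB.instance Definition _ (K : unitalLGroup) :=
  [SubChoice_isSubPOrder of Gamma K by <: with lgroup_display].

Section GammaOperations.
Variable K : unitalLGroup.
Local Notation M := (Gamma K).
Local Notation v := (ul_unit K).
Implicit Types x y : M.

Fact pmv_zero_subproof : (1 : K) <= 1 <= v.
Proof. by rewrite lexx; case: (ul_unitP K). Qed.

Fact pmv_oplus_subproof x y : 1 <= (gval x * gval y) `&` v <= v.
Proof.
rewrite leIr andbT lexI; case: (ul_unitP K) => -> _; rewrite andbT.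
case/andP: (gvalP x) => x0 _; case/andP: (gvalP y) => y0 _.
by apply: (le_trans y0); rewrite -{1}[gval y]mul1g lg_leM2r.
Qed.

Fact pmv_lneg_subproof x : 1 <= v / gval x <= v.
Proof.
case/andP: (gvalP x) => x0 xv; rewrite -(lg_leM2r x) mul1g mulgVK xv /=.
by rewrite -(lg_leM2r x) mulgVK -{1}[v]mulg1 lg_leM2l.
Qed.

Fact pmv_rneg_subproof x : 1 <= (gval x)^-1 * v <= v.
Proof.
case/andP: (gvalP x) => x0 xv; rewrite -(lg_leM2l x) mulg1 mulVKg xv /=.
by rewrite -(lg_leM2l x) mulVKg -{1}[v]mul1g lg_leM2r.
Qed.

Definition pmv_zero : M := GammaElt pmv_zero_subproof.
Definition pmv_oplus x y : M := GammaElt (pmv_oplus_subproof x y).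
(* x^- = v - x and x^~ = - x + v *)
Definition pmv_lneg x : M := GammaElt (pmv_lneg_subproof x).
Definition pmv_rneg x : M := GammaElt (pmv_rneg_subproof x).

Definition pmv_odot x y : M := pmv_rneg (pmv_oplus (pmv_lneg y) (pmv_lneg x)).
(* x -> y = x^- (+) y and x ~> y = y (+) x^~ *)
Definition pmv_limp x y : M := pmv_oplus (pmv_lneg x) y.
Definition pmv_rimp x y : M := pmv_oplus y (pmv_rneg x).

Lemma gval_odot x y : gval (pmv_odot x y) = (gval x / v * gval y) `|` 1.
Proof.
by rewrite /= lg_invg_meet lg_joinM mulVg !invgM !invgK !mulgA mulgVK.
Qed.

Record is_square_root (r : M -> M) : Prop := IsSquareRoot {
  sq1 : forall x, pmv_odot (r x) (r x) = x;
  sq2 : forall x y, pmv_odot y y <= x -> y <= r x;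
  sq3_lneg : forall x, r (pmv_lneg x) = pmv_limp (r x) (r pmv_zero);
  sq3_rneg : forall x, r (pmv_rneg x) = pmv_rimp (r x) (r pmv_zero)
}.

End GammaOperations.

(* An additive subgroup H of R, as a type; its groupType structure is
   addition: x * y in this type is x + y in R. *)
Record subgroup (R : realType) (H : zmodClosed R) := SubgroupElt {
  sgval :> R;
  sgvalP : sgval \in H
}.

Section Subgroup.
Variables (R : realType) (H : zmodClosed R).
Local Notation T := (subgroup H).
Implicit Types x y z : T.

HB.instance Definition _ := [isSub for @sgval R H].
HB.instance Definition _ := [Choice of T by <:].

Definition sg_zero : T := SubgroupElt (GRing.rpred0 H).
Definition sg_add x y : T := SubgroupElt (GRing.rpredD (sgvalP x) (sgvalP y)).
Fact sg_opp_subproof x : (- sgval x)%R \in H.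
Proof. by rewrite GRing.rpredN sgvalP. Qed.
Definition sg_opp x : T := SubgroupElt (sg_opp_subproof x).

Fact sg_addA : associative sg_add.
Proof. by move=> x y z; apply/val_inj/GRing.addrA. Qed.
Fact sg_add0r : left_id sg_zero sg_add.
Proof. by move=> x; apply/val_inj/GRing.add0r. Qed.
Fact sg_addr0 : right_id sg_zero sg_add.
Proof. by move=> x; apply/val_inj/GRing.addr0. Qed.
Fact sg_addNr : left_inverse sg_zero sg_opp sg_add.
Proof. by move=> x; apply/val_inj/GRing.addNr. Qed.
Fact sg_addrN : right_inverse sg_zero sg_opp sg_add.
Proof. by move=> x; apply/val_inj/GRing.addrN. Qed.

HB.instance Definition _ :=
  isGroup.Build T sg_addA sg_add0r sg_addr0 sg_addNr sg_addrN.
HB.instance Definition _ :=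
  [SubChoice_isSubOrder of T by <: with lgroup_display].

Lemma sg_leE x y : (x <= y) = (sgval x <= sgval y)%R.
Proof. by []. Qed.
Lemma sg_ltE x y : (x < y) = (sgval x < sgval y)%R.
Proof. by []. Qed.

Fact sg_leM2 (a b x y : T) : x <= y -> a * x * b <= a * y * b.
Proof. by rewrite !sg_leE /= Num.Theory.lerD2r Num.Theory.lerD2l. Qed.

HB.instance Definition _ := isLGroup.Build T sg_leM2.

End Subgroup.

(* The library orders H *lexi[_] G lexicographically, but has no lattice
   structure on it unless both factors are chains. *)
Definition lex_prod (H : totalLGroupType) (G : lGroupType) : Type :=
  (H *lexi[lgroup_display] G)%type.

Section LexProd.
Variables (H : totalLGroupType) (G : lGroupType).
Local Notation L := (lex_prod H G).
Implicit Types x y z : L.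

HB.instance Definition _ :=
  Order.POrder.copy L (H *lexi[lgroup_display] G)%type.
HB.instance Definition _ := Group.copy L (H * G)%type.

Lemma lex_leE x y : (x <= y) = (x.1 < y.1) || (x.1 == y.1) && (x.2 <= y.2).
Proof. by rewrite [LHS]leEprodlexi; case: ltgtP. Qed.

Definition lex_meet x y : L :=
  if x.1 < y.1 then x else if y.1 < x.1 then y else (x.1, x.2 `&` y.2).
Definition lex_join x y : L :=
  if x.1 < y.1 then y else if y.1 < x.1 then x else (x.1, x.2 `|` y.2).

Fact lex_meetP x y z : (x <= lex_meet y z) = (x <= y) && (x <= z).
Proof.
rewrite /lex_meet; case: (ltgtP y.1 z.1) => [yz|zy|e]; rewrite !lex_leE /=.
- case: (ltgtP x.1 y.1) => [xy|//|xy] /=; first by rewrite (lt_trans xy yz).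
  by rewrite xy yz andbT.
- case: (ltgtP x.1 z.1) => [xz|zx|xz] /=; last by rewrite xz zy.
    by rewrite (lt_trans xz zy).
  by rewrite andbF.
- by rewrite -e; case: (ltgtP x.1 y.1) => //= _; rewrite lexI.
Qed.

Fact lex_joinP x y z : (lex_join x y <= z) = (x <= z) && (y <= z).
Proof.
rewrite /lex_join; case: (ltgtP x.1 y.1) => [xy|yx|e]; rewrite !lex_leE /=.
- case: (ltgtP y.1 z.1) => [yz|_|yz] /=; first by rewrite (lt_trans xy yz).
    by rewrite andbF.
  by rewrite -yz xy.
- case: (ltgtP x.1 z.1) => [xz|//|xz] /=; first by rewrite (lt_trans yx xz).
  by rewrite -xz yx andbT.
- by rewrite -e; case: (ltgtP x.1 z.1) => //= _; rewrite leUx.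
Qed.

HB.instance Definition _ :=
  Order.POrder_MeetJoin_isLattice.Build lgroup_display L
    lex_meetP lex_joinP.

Fact lex_leM2 (a b x y : L) : x <= y -> a * x * b <= a * y * b.
Proof.
have lt_ndM (c d t u : H) : (c * t * d < c * u * d) = (t < u).
  by rewrite !ltNge lg_leM2r lg_leM2l.
rewrite !lex_leE /= lt_ndM => /orP[->//|/andP[/eqP-> le2]].
by rewrite eqxx lg_leM2r lg_leM2l le2 orbT.
Qed.

HB.instance Definition _ := isLGroup.Build L lex_leM2.

End LexProd.

Section UnitalLex.
Variables (R : realType) (H : zmodClosed R) (H1 : (1 : R)%R \in H).
Variable G : lGroupType.

Definition lex_unit : lex_prod (subgroup H) G := (SubgroupElt H1, 1).

Fact lex_unitP : strong_unit lex_unit.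
Proof.
have sgX n : sgval ((SubgroupElt H1 : subgroup H) ^+ n) = (n%:R)%R.
  by elim: n => [//|n IH]; rewrite expgS /= IH -GRing.natr1 GRing.addrC.
have unitX n : lex_unit ^+ n = ((SubgroupElt H1 : subgroup H) ^+ n, 1).
  elim: n => [//|n IH]; rewrite !expgS IH.
  by apply: injective_projections => //=; rewrite mulg1.
split=> [|g]; first by rewrite lex_leE sg_ltE /= Num.Theory.ltr01.
exists (Num.bound (sgval g.1)).+1 => //.
rewrite lex_leE unitX sg_ltE sgX; apply/orP; left.
have [x0|/ltW x0] := Order.TotalTheory.leP 0%R (sgval g.1).
  apply: lt_trans (Num.Theory.archi_boundP x0) _.
  by rewrite Num.Theory.ltr_nat.
by apply: Order.POrderTheory.le_lt_trans x0 _; rewrite Num.Theory.ltr0n.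
Qed.

Definition lex_unital : unitalLGroup := UnitalLGroup lex_unitP.

End UnitalLex.

(* Main.v *)
Require Import Defs.
From mathcomp Require Import all_boot all_order all_algebra.
From mathcomp Require Import classical_sets cardinality reals.
From mathcomp Require Import boolp functions lra.

(** Write the elements of M as pairs (a, g), with a in H between 0 and 1, and
    let r be a square root.  In M, the element (b, k) o (b, k) is the positive
    part of (2b - 1, 2k).  Hence, when a > 0, the equation r(a, g) o r(a, g) =
    (a, g) determines the first coordinate of r(a, g), namely (a + 1) / 2, and
    makes the second coordinate of r(a, g) a half of g
    ([square_root_of_positive_height]).

    First, H meets the open interval ]0, 1[ ([exists_interior_height]).
    Otherwise every element of M has first coordinate 0 or 1, so r(0) = (0, t);
    all (0, h) with h >= 0 have square 0, so maximality of r(0) makes t the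
    greatest element of the positive cone of G, which forces G to be trivial.
    Then M has at most two elements.

    Next, if a is in H and 0 < a < 1, then H contains (a + 1) / 2 and
    ((1 - a) + 1) / 2, whose sum is 3/2; so 1/2 is in H, and splitting an
    element of H into its integral and fractional parts shows that H is closed
    under halving ([halves_of_shifted_halves]).

    Finally, for g in G put x = (1/2, g), so that r(x) = (3/4, t) with 2t = g.
    Any k with 2k = g gives (3/4, k) o (3/4, k) = x, hence (3/4, k) <= r(x) by
    maximality, that is k <= t: the halves of g exist and have a greatest
    element. *)

Local Open Scope classical_set_scope.
Local Open Scope card_scope.
Local Open Scope group_scope.

Import Order.TTheory GRing.Theory Num.Theory.

Set Implicit Arguments.
Unset Strict Implicit.
Unset Printing Implicit Defensive.

(** The positive cone is closed under doubling, so its greatest element t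
    satisfies 2t <= t, that is t <= 0. *)
Lemma positive_cone_top_trivial (G : lGroupType) (t : G) :
  (forall h : G, (1 <= h)%O -> (h <= t)%O) -> forall g : G, g = 1.
Proof.
move=> top_t.
have t1 : (1 <= t)%O by exact: top_t.
have tle1 : (t <= 1)%O.
  rewrite -(lg_leM2l t) mulg1; apply: top_t.
  by apply: (le_trans t1); rewrite -{1}[t]mulg1 lg_leM2l.
have le1 (g : G) : (g <= 1)%O.
  by apply: le_trans tle1; apply: (le_trans (leUl g 1)); apply/top_t/leUr.
by move=> g; apply/le_anti; rewrite le1 -lg_leV2 invg1 le1.
Qed.

(** Both a and 1 - a lie in the open unit interval, and their shifted halves
    add up to 3/2; this yields 1/2, after which the integral part of an element
    can be halved and its fractional part unshifted. *)
Lemma halves_of_shifted_halves (R : realType) (H : zmodClosed R) (a : R) :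
  (1 : R)%R \in H -> a \in H -> (0 < a < 1)%R ->
  (forall x : R, x \in H -> (0 < x < 1)%R -> ((x + 1) / 2)%R \in H) ->
  forall x : R, x \in H -> (x / 2)%R \in H.
Proof.
move=> H1 Ha /andP[a0 a1] half.
have Hhalf : (1 / 2 : R)%R \in H.
  have -> : (1 / 2 = (a + 1) / 2 + ((1 - a) + 1) / 2 - 1 :> R)%R by lra.
  rewrite rpredB ?rpredD ?half ?rpredB ?a0 ?a1 //.
  by apply/andP; split; lra.
move=> x Hx; set m := Num.floor x.
have /andP[mx xm] : (m%:~R <= x < m%:~R + 1)%R.
  by have := Num.Theory.floor_itv x; rewrite intrD.
have Hm : (m%:~R / 2 : R)%R \in H.
  by have := rpredMz m Hhalf; rewrite -mulrzl mulrA mulr1.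
have Hf : (x - m%:~R)%R \in H by rewrite rpredB // rpredMz.
have [f0|f0] := eqVneq (x - m%:~R)%R 0%R.
  by have -> : x = (m%:~R)%R by apply/eqP; rewrite -subr_eq0 f0.
have -> : (x / 2 = (x - m%:~R + 1) / 2 - 1 / 2 + m%:~R / 2)%R by lra.
rewrite rpredD ?rpredB ?half // lt_neqAle eq_sym f0 /=.
by apply/andP; split; lra.
Qed.

Definition height (R : realType) (H : zmodClosed R) (H1 : (1 : R)%R \in H)
  (G : lGroupType) (x : Gamma (lex_unital H1 G)) : R := sgval (gval x).1.

Lemma height_bounds (R : realType) (H : zmodClosed R) (H1 : (1 : R)%R \in H)
  (G : lGroupType) (x : Gamma (lex_unital H1 G)) : (0 <= height x <= 1)%R.
Proof.
rewrite /height; case/andP: (gvalP x); rewrite !lex_leE !sg_ltE -!val_eqE /=.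
case/orP=> [/ltW ->|/andP[/eqP<- _]];
  by case/orP=> [/ltW ->|/andP[/eqP-> _]]; rewrite ?lexx ?ler01.
Qed.

Lemma interior_in_Gamma (R : realType) (H : zmodClosed R) (H1 : (1 : R)%R \in H)
    (G : lGroupType) (a : R) (Ha : a \in H) (g : G) : (0 < a < 1)%R ->
  ((1 : lex_unital H1 G)
    <= ((SubgroupElt Ha, g) : lex_prod (subgroup H) G)
    <= ul_unit (lex_unital H1 G))%O.
Proof. by case/andP=> a0 a1; rewrite !lex_leE !sg_ltE /= a0 a1. Qed.

Lemma height_odot_self (R : realType) (H : zmodClosed R) (H1 : (1 : R)%R \in H)
    (G : lGroupType) (y : Gamma (lex_unital H1 G)) :
  height (pmv_odot y y) = Num.max (height y + height y - 1)%R 0%R.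
Proof.
rewrite /height gval_odot [Order.join _ _]/(lex_join _ _) /lex_join !sg_ltE /=.
by rewrite addrAC /Order.max /=; case: ltgtP => //= _; rewrite addrAC.
Qed.

Lemma snd_odot_self (R : realType) (H : zmodClosed R) (H1 : (1 : R)%R \in H)
    (G : lGroupType) (y : Gamma (lex_unital H1 G)) :
  (1 < height y + height y)%R ->
  (gval (pmv_odot y y)).2 = (gval y).2 ^+ 2.
Proof.
rewrite /height => y1.
rewrite gval_odot [Order.join _ _]/(lex_join _ _) /lex_join !sg_ltE /=.
have u0 : (0 < sgval (gval y).1 - 1 + sgval (gval y).1)%R by lra.
by rewrite (lt_gtF u0) u0 /= invg1 mulg1 expgS expg1.
Qed.

(** Since x = r(x) o r(x) has positive height, it is the untruncated double of
    r(x) minus the unit, and both coordinates can be read off. *)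
Lemma square_root_of_positive_height (R : realType) (H : zmodClosed R)
    (H1 : (1 : R)%R \in H) (G : lGroupType)
    (r : Gamma (lex_unital H1 G) -> Gamma (lex_unital H1 G)) :
  is_square_root r -> forall x, (0 < height x)%R ->
  (height (r x) = (height x + 1) / 2)%R /\ (gval (r x)).2 ^+ 2 = (gval x).2.
Proof.
move=> sqr x x0; have rx := sq1 sqr x.
have hx := height_odot_self (r x); rewrite rx in hx.
have rx1 : (1 < height (r x) + height (r x))%R.
  by move: x0; rewrite hx lt_max ltxx orbF subr_gt0.
split; last by rewrite -snd_odot_self // rx.
by move: hx; rewrite max_l; lra.
Qed.

(** Over H = Z the elements (0, h), h >= 0, all have square 0, and only a
    trivial G lets r(0) bound them; M is then the two-element algebra. *)
Lemma exists_interior_height (R : realType) (H : zmodClosed R)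
    (H1 : (1 : R)%R \in H) (G : lGroupType)
    (r : Gamma (lex_unital H1 G) -> Gamma (lex_unital H1 G)) :
  `I_3 #<= [set: Gamma (lex_unital H1 G)] -> is_square_root r ->
  exists2 a : R, a \in H & (0 < a < 1)%R.
Proof.
move=> card3 sqr; apply: contrapT => noH.
have height01 (x : Gamma (lex_unital H1 G)) : height x = 0%R \/ height x = 1%R.
  have /andP[x0 x1] := height_bounds x.
  have [e0|n0] := eqVneq (height x) 0%R; first by left.
  have [e1|n1] := eqVneq (height x) 1%R; first by right.
  case: noH; exists (height x); first exact: sgvalP.
  by rewrite !lt_neqAle x0 x1 n1 eq_sym n0.
set o := pmv_zero (lex_unital H1 G).
have ro : height (r o) = 0%R.
  have := height_odot_self (r o); rewrite (sq1 sqr).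
  case: (height01 (r o)) => // ->; rewrite {1}/height /= max_l; lra.
have trivG : forall g : G, g = 1.
  apply: (@positive_cone_top_trivial _ (gval (r o)).2) => h h1.
  (* Inside the group of pairs, 1 is the zero of H. *)
  have hP : ((1 : lex_unital H1 G)
      <= ((1, h) : lex_prod (subgroup H) G) <= ul_unit (lex_unital H1 G))%O.
    by rewrite !lex_leE !sg_ltE /= ltxx eqxx h1 ltr01.
  have : (gval (GammaElt hP) <= gval (r o))%O.
    apply: (sq2 sqr).
    have : (gval (pmv_odot (GammaElt hP) (GammaElt hP))
             <= (1 : lex_unital H1 G))%O.
      rewrite gval_odot [Order.join _ _]/(lex_join _ _) /lex_join !sg_ltE /=.
      have -> : (0 - 1 + 0 < 0 :> R)%R by lra.
      exact: lexx.
    by [].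
  have ro1 : (gval (r o)).1 = 1 by apply: val_inj; exact: ro.
  by rewrite lex_leE /= ro1 ltxx eqxx.
have inj_h (x y : Gamma (lex_unital H1 G)) : height x = height y -> x = y.
  move=> e; apply: val_inj; apply: injective_projections.
    by apply: val_inj.
  by rewrite [LHS]trivG [RHS]trivG.
(* Heights now identify the elements of M, and take two values. *)
have /card_leP[f] := card3.
pose p i (i3 : (i < 3)%N) := height (set_val (f (exist _ i (mem_set i3)))).
have p_inj i j (i3 : (i < 3)%N) (j3 : (j < 3)%N) : p i i3 = p j j3 -> i = j.
  by move=> /inj_h/val_inj/inj; rewrite !inE => /(_ I I) [].
have p01 i (i3 : (i < 3)%N) : p i i3 = 0%R \/ p i i3 = 1%R by apply: height01.
have := @p_inj 0%N 1%N isT isT; have := @p_inj 0%N 2%N isT isT.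
have := @p_inj 1%N 2%N isT isT.
case: (p01 0%N isT) (p01 1%N isT) (p01 2%N isT) => -> [] -> [] -> n12 n02 n01;
  by [have := n12 erefl | have := n02 erefl | have := n01 erefl].
Qed.

Theorem theorem4p20 (R : realType) (H : zmodClosed R) (H1 : (1 : R)%R \in H)
    (G : lGroupType) :
  let M : Type := Gamma (lex_unital H1 G) in
  `I_3 #<= [set: M] ->
  (exists r : M -> M, is_square_root r) ->
  (unique_root_extraction G ->
     two_divisible (subgroup H) /\ two_divisible G) /\
  (~ unique_root_extraction G ->
     forall g : G, exists t : G, top_element [set x : G | x ^+ 2 = g] t).
Proof.
move=> M card3 [r sqr].
have half : forall x : R, x \in H -> (x / 2)%R \in H.
  have [a Ha a01] := exists_interior_height card3 sqr.
  apply: (halves_of_shifted_halves H1 Ha a01) => b Hb b01.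
  pose x : M := GammaElt (interior_in_Gamma H1 Hb (1 : G) b01).
  have [|<- _] := square_root_of_positive_height sqr (x := x); last exact: sgvalP.
  by have /andP[] := b01.
have top (g : G) : exists t, top_element [set x : G | x ^+ 2 = g] t.
  have a01 : (0 < 1 / 2 :> R)%R && (1 / 2 < 1 :> R)%R by apply/andP; split; lra.
  pose x : M := GammaElt (interior_in_Gamma H1 (half 1%R H1) g a01).
  have [|hx rx] := square_root_of_positive_height sqr (x := x).
    by have /andP[] := a01.
  have hE : height x = (1 / 2)%R by [].
  exists (gval (r x)).2; split=> // k /= k2.
  have b01 : (0 < height (r x) < 1)%R by rewrite hx hE; apply/andP; split; lra.
  pose y : M := GammaElt (interior_in_Gamma H1 (sgvalP (gval (r x)).1) k b01).
  have hy : height y = height (r x) by [].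
  have : (gval y <= gval (r x))%O.
    apply: (sq2 sqr).
    have e : pmv_odot y y = x.
      apply: val_inj; apply: injective_projections.
        apply: val_inj; change (height (pmv_odot y y) = height x).
        by rewrite height_odot_self hy hx hE max_l; lra.
      by rewrite [LHS]snd_odot_self // hy hx hE; lra.
    by rewrite e.
  have y1 : (gval y).1 = (gval (r x)).1 by apply: val_inj.
  by rewrite lex_leE y1 ltxx eqxx.
split=> // _; split=> [h|g]; last by have [t [tg _]] := top g; exists t.
exists (SubgroupElt (half _ (sgvalP h))); apply: val_inj => /=.
by rewrite -splitr.
Qed.
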